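(* $\textsc{Nephew-w-Inverse}$ reduces (by a black-box $\le_{dt}$ reduction) to $\textsc{Empty-Child}'$.
   Context: Query model with $\le_{dt}$ reductions (decision-tree reductions with log target-input-length plus depth $\mathrm{polylog}$ in the source size). $\textsc{Nephew-w-Inverse}$: given a finite set $V=[N]$, functions $f,g:V\to V$ and $f^{-1}:V\to V\cup\{\bot\}$, a solution is $u$ with $f(f(g(u)))\ne f(u)$; or $u$ with $f(g(u))=u$; or $v$ with $f^{-1}(v)\ne\bot$ and $f(f^{-1}(v))\ne v$; or $v$ with $f^{-1}(v)=\bot$ and $f(f(v))\ne f(v)$. $\textsc{Empty-Child}'$: given $V'=[K]$ and $F,L,R:V'\to V'$, a solution is (s1) $u$ with $F(L(u))\ne u$ or $F(R(u))\ne u$ or $L(u)=R(u)\ne u$, or (s2a) $1$ if $L(1)=1$ or $R(1)=1$. *)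

(* Defs.v *)
From mathcomp Require Import all_boot.

Set Implicit Arguments.
Unset Strict Implicit.
Unset Printing Implicit Defensive.

(* An input assigns to every position [q : qry] a symbol of the finite alphabet
   [ans q]; neither totality nor cheap verifiability is part of the record. *)
Record search_problem := SearchProblem {
  qry : finType;
  ans : qry -> finType;
  sol : finType;
  solves : (forall q, ans q) -> sol -> Prop
}.

Definition input (P : search_problem) : Type := forall q : qry P, ans q.

(* Number of bits needed to write one symbol: the ceiling of log2 of the size
   of the alphabet. *)
Definition sym_bits (P : search_problem) (q : qry P) : nat :=
  up_log 2 #|ans q|.

Definition input_length (P : search_problem) : nat :=
  \sum_(q : qry P) sym_bits q.

Inductive dtree (P : search_problem) (O : Type) : Type :=
| Leaf of O
| Query (q : qry P) of (ans q -> dtree P O).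

Fixpoint dt_eval (P : search_problem) (O : Type) (t : dtree P O)
    (x : input P) : O :=
  match t with
  | Leaf o => o
  | Query q k => dt_eval (k (x q)) x
  end.

(* Depth is counted in bits: reading a symbol costs [sym_bits], as it would if
   the input were a bit string.  Counting one per symbol instead changes the
   depth by at most a factor log (max alphabet size). *)
Fixpoint dt_depth (P : search_problem) (O : Type) (t : dtree P O) : nat :=
  match t with
  | Leaf _ => 0
  | Query q k => sym_bits q + \max_(a : ans q) dt_depth (k a)
  end.

Definition dt_formulation (P Q : search_problem) (d : nat) : Prop :=
  exists (T : forall q : qry Q, dtree P (ans q))
         (G : sol Q -> dtree P (sol P)),
    [/\ forall q, dt_depth (T q) <= d,
        forall o, dt_depth (G o) <= d
      & forall (x : input P) (o : sol Q),
          solves (fun q => dt_eval (T q) x) o -> solves x (dt_eval (G o) x)].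

(* A bound [log^O(1)]; the offset 2 only serves to make the bound
   non-degenerate for inputs of length at most 2. *)
Definition dt_reducible (P Q : nat -> search_problem) : Prop :=
  exists c : nat, forall n : nat, exists m d : nat,
    dt_formulation (P n) (Q m) d /\
    up_log 2 (input_length (Q m)) + d
      <= (up_log 2 (input_length (P n)) + 2) ^ c.

Definition nephew_w_inverse_solution (N : nat) (f g : 'I_N -> 'I_N)
    (finv : 'I_N -> option 'I_N) (u : 'I_N) : Prop :=
  [\/ f (f (g u)) <> f u,
      f (g u) = u,
      exists2 w, finv u = Some w & f w <> u
    | finv u = None /\ f (f u) <> f u].

(* The positions [inl (inl u)], [inl (inr u)] and [inr v] hold f u, g u and
   f^-1 v, with [None] for bottom. *)
Definition nephew_w_inverse_qry (N : nat) : finType :=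
  ('I_N + 'I_N + 'I_N)%type.

Definition nephew_w_inverse_ans (N : nat) (q : nephew_w_inverse_qry N)
    : finType :=
  match q with
  | inl _ => 'I_N
  | inr _ => option 'I_N
  end.

(* The index n stands for the vertex set of N = n + 1 elements: on the empty
   set there is nothing to find. *)
Definition Nephew_w_Inverse (n : nat) : search_problem :=
  @SearchProblem (nephew_w_inverse_qry n.+1) (@nephew_w_inverse_ans n.+1) 'I_n.+1
    (fun x => nephew_w_inverse_solution
       (fun u => x (inl (inl u))) (fun u => x (inl (inr u)))
       (fun v => x (inr v))).

(* The distinguished vertex 1 of {1, ..., K} is [ord0 : 'I_k.+1], K = k + 1. *)
Definition empty_child'_solution (k : nat) (F L R : 'I_k.+1 -> 'I_k.+1)
    (u : 'I_k.+1) : Prop :=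
  [\/ F (L u) <> u,
      F (R u) <> u,
      L u = R u /\ R u <> u
    | u = ord0 /\ (L ord0 = ord0 \/ R ord0 = ord0)].

(* The positions [inl (inl u)], [inl (inr u)] and [inr u] hold F u, L u and
   R u. *)
Definition Empty_Child' (k : nat) : search_problem :=
  @SearchProblem ('I_k.+1 + 'I_k.+1 + 'I_k.+1)%type (fun=> 'I_k.+1) 'I_k.+1
    (fun x => empty_child'_solution
       (fun u => x (inl (inl u))) (fun u => x (inl (inr u)))
       (fun u => x (inr u))).

(* Main.v *)
(** Call [sib u = f (g u)] the sibling of [u].  Away from solutions it is a
    second child of [f u], distinct from [u], and it has itself a child.  The
    binary tree of the reduction gives a vertex [v] the children [w] and
    [sib w], where [w] is a child of [v]; when [f v = v], the children are [v]
    itself and [sib v].  Vertices without a known child are made isolated,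
    which is harmless because they only occur below fixed points of [f], and
    such a fixed point uses none of them as a child.  The root must be neither
    isolated nor a fixed point: [0] or [sib (f 0)] will do, and it is moved to
    the position [0] by a transposition. *)
Require Import Defs.
From mathcomp Require Import all_boot perm.

Set Implicit Arguments.
Unset Strict Implicit.
Unset Printing Implicit Defensive.

(** * The binary tree built from a Nephew instance *)

Section Tree.

Variables (V : finType) (o : V) (f g : V -> V) (finv : V -> option V).

Definition bad (u : V) : bool :=
  [|| f (f (g u)) != f u, f (g u) == u,
      (if finv u is Some w then f w != u else false)
    | (finv u == None) && (f (f u) != f u)].

Definition sib (u : V) : V := f (g u).

(* If [finv v] is empty then [f v] should be a fixed point, so that [v] has the
   child [g (f v)] whenever [v] is the sibling of [f v]. *)
Definition child (v : V) : V := if finv v is Some w then w else g (f v).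

Definition has_child (v : V) : bool := f (child v) == v.

Definition parent (v : V) : V := if has_child v then f v else v.

Definition left_child (v : V) : V :=
  if has_child v then if f v == v then v else child v else v.

Definition right_child (v : V) : V :=
  if has_child v then if f v == v then sib v else sib (child v) else v.

Definition root : V := if has_child o && (f o != o) then o else sib (f o).

Definition bad_or (u w : V) : V := if bad u then u else w.

(** The first four candidates are the vertices that [treeP] needs to be good, the last three those
    that [rootP] needs. The result is bad as soon as one candidate is. *)
Definition tree_witness (u : V) : V :=
  bad_or u (bad_or (sib u) (bad_or (child u) (bad_or (sib (child u))
    (bad_or o (bad_or (f o) (sib (f o))))))).

Lemma good_bad_or (u w : V) : ~~ bad (bad_or u w) = ~~ bad u && ~~ bad w.
Proof. by rewrite /bad_or; case: ifP => /= [-> | _]. Qed.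

Lemma f_sib (u : V) : ~~ bad u -> f (sib u) = f u.
Proof. by case/norP=> /negPn/eqP. Qed.

Lemma sib_neq (u : V) : ~~ bad u -> sib u != u.
Proof. by case/norP=> _ /norP[]. Qed.

(** At a good vertex a nonempty [finv v] holds a true preimage, hence a child. So [finv v] is empty
    here, and the last clause of [bad] applies. *)
Lemma no_child_fixed (v : V) : ~~ bad v -> ~~ has_child v -> f (f v) = f v.
Proof.
case/norP=> _ /norP[_ /norP[]]; rewrite /has_child /child.
by case: (finv v) => [w /negPn-> | _] //= /negPn/eqP.
Qed.

Lemma nonfixed_has_child (v : V) : ~~ bad v -> f (f v) != f v -> has_child v.
Proof. by move=> bv; apply: contraR => /(no_child_fixed bv) ->. Qed.

(** If [finv (sib r)] is empty, the fallback child is [g (f (sib r)) = g r], and [f (g r)] is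
    [sib r] by definition. *)
Lemma has_child_sib_fixed (r : V) :
  f r = r -> ~~ bad r -> ~~ bad (sib r) -> has_child (sib r).
Proof.
move=> fr br; have fs := f_sib br; rewrite fr in fs.
case/norP=> _ /norP[_ /norP[]]; rewrite /has_child /child.
by case: (finv (sib r)) => [w /negPn | _ _] //; rewrite fs.
Qed.

Lemma treeP (v : V) : ~~ bad v -> ~~ bad (sib v) -> ~~ bad (child v) ->
    ~~ bad (sib (child v)) ->
  [/\ parent (left_child v) = v, parent (right_child v) = v
    & left_child v = right_child v -> right_child v = v].
Proof.
move=> bv bsv bc bsc; rewrite /left_child /right_child.
have [hv | /negbTE hv] := boolP (has_child v); last by rewrite /parent hv.
have [fv | nfv] := eqVneq (f v) v.
  (* The right child [sib v] of a fixed point is not isolated, so [parent] sends it to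
     [f (sib v) = f v = v]. *)
  rewrite {1}/parent hv fv /parent has_child_sib_fixed // f_sib // fv.
  by split=> // vs; move/eqP: (sib_neq bv).
have fc : f (child v) = v by apply/eqP.
have fs : f (sib (child v)) = v by rewrite f_sib.
(* Since [f] moves [v], which is the image of both children, neither child is isolated and [parent]
   agrees with [f] on them. *)
have hc : has_child (child v) by apply: nonfixed_has_child; rewrite ?fc.
have hs : has_child (sib (child v)) by apply: nonfixed_has_child; rewrite ?fs.
by rewrite /parent hc hs fc fs; split=> // cs; case/eqP: (sib_neq bc).
Qed.

Lemma rootP : ~~ bad o -> ~~ bad (f o) -> ~~ bad (sib (f o)) ->
  has_child root /\ f root != root.
Proof.
move=> bo bfo bs; rewrite /root; case: ifPn => [/andP[] // | no].
(* When [o] is unsuitable, [f o] is a fixed point, and its sibling is then a non-fixed vertex with a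
   child. *)
have ffo : f (f o) = f o.
  have [fo | ho] := eqVneq (f o) o; first by rewrite !fo.
  by apply: no_child_fixed => //; move: no; rewrite ho andbT.
split; first exact: has_child_sib_fixed.
by rewrite f_sib // ffo eq_sym sib_neq.
Qed.

(** Both children are sent to [v] by [f], so a child equal to [v] would make [v] a fixed point. *)
Lemma children_neq (v : V) : has_child v -> f v != v -> ~~ bad (child v) ->
  left_child v != v /\ right_child v != v.
Proof.
move=> hv nfv bc; rewrite /left_child /right_child hv (negbTE nfv).
have fc : f (child v) = v by apply/eqP.
by split; apply: contra_neq nfv => {1}<-; rewrite ?f_sib.
Qed.

Lemma tree_witnessP (v : V) :
  [\/ parent (left_child v) <> v, parent (right_child v) <> v,
      left_child v = right_child v /\ right_child v <> v
    | v = root /\ (left_child v = v \/ right_child v = v)] ->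
  bad (tree_witness v).
Proof.
move=> sol; apply: contraT; rewrite /tree_witness !good_bad_or.
case/and5P=> bv bsv bc bsc /and3P[bo bfo bs].
have [Lv Rv LR] := treeP bv bsv bc bsc.
have [hr nfr] := rootP bo bfo bs.
case: sol => [// | // | [/LR//] | [vr]]; rewrite -vr in hr nfr.
by have [/eqP nL /eqP nR] := children_neq hr nfr bc; case.
Qed.

(** * Moving the root to the distinguished position *)

Definition move_root (h : V -> V) (v : V) : V :=
  tperm o root (h (tperm o root v)).

(** Conjugating the three maps by one involution carries a solution at [v] to a solution at
    [tperm o root v], and [o] to [root]. *)
Lemma move_root_witnessP (v : V) (F := move_root parent)
    (L := move_root left_child) (R := move_root right_child) :
  [\/ F (L v) <> v, F (R v) <> v, L v = R v /\ R v <> v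
    | v = o /\ (L o = o \/ R o = o)] ->
  bad (tree_witness (tperm o root v)).
Proof.
have inv u w : tperm o root u = w -> u = tperm o root w.
  by move=> <-; rewrite tpermK.
have rt : root = tperm o root o by rewrite tpermL.
rewrite /F /L /R /move_root !tpermK => sol; apply: tree_witnessP.
case: sol => [FL | FR | [LR nR] | [-> LR]].
- by apply: Or41 => e; apply: FL; rewrite e tpermK.
- by apply: Or42 => e; apply: FR; rewrite e tpermK.
- apply: Or43; split; first exact: perm_inj LR.
  by move=> e; apply: nR; rewrite e tpermK.
- apply: Or44; rewrite tpermL; split=> //.
  by case: LR => /inv; rewrite !tpermL; [left | right].
Qed.

End Tree.

(** * A calculus of query costs for decision trees *)

Section Computation.

Variable P : search_problem.

Fixpoint dt_bind (A B : Type) (t : dtree P A) (k : A -> dtree P B) :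
    dtree P B :=
  match t with
  | Leaf a => k a
  | Query q s => Query (fun a : ans q => dt_bind (s a) k)
  end.

Lemma dt_eval_bind (A B : Type) (t : dtree P A) (k : A -> dtree P B)
    (x : input P) : dt_eval (dt_bind t k) x = dt_eval (k (dt_eval t x)) x.
Proof. by elim: t => //= q s IH. Qed.

Lemma dt_depth_bind (A B : Type) (t : dtree P A) (k : A -> dtree P B) (d : nat) :
  (forall a, dt_depth (k a) <= d) -> dt_depth (dt_bind t k) <= dt_depth t + d.
Proof.
move=> kd; elim: t => [a | q s IH] //=; rewrite -addnA leq_add2l.
apply/bigmax_leqP => a _; apply: leq_trans (IH a) _.
by rewrite leq_add2r (leq_bigmax a).
Qed.

Variable b : nat.

(** With [b] a bound on the bits of one symbol, [k] is a budget of queries along a path. *)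
Definition computable (O : Type) (k : nat) (h : input P -> O) : Prop :=
  exists2 t : dtree P O, dt_depth t <= k * b & forall x, dt_eval t x = h x.

Lemma computable_const (O : Type) (c : O) : computable 0 (fun=> c).
Proof. by exists (Leaf P c). Qed.

Lemma computable_query (q : qry P) :
  @sym_bits P q <= b -> computable 1 (fun x => x q).
Proof.
move=> qb; exists (Query (fun a => Leaf P a)) => //=.
by rewrite mul1n big1 ?addn0.
Qed.

Lemma computable_le (O : Type) (k l : nat) (h : input P -> O) :
  k <= l -> computable k h -> computable l h.
Proof.
by move=> kl [t td te]; exists t; rewrite // (leq_trans td) // leq_mul2r kl orbT.
Qed.

Lemma computable_bind (A : finType) (B : Type) (k l : nat)
    (h : input P -> A) (h' : A -> input P -> B) :
    computable k h -> (forall a, computable l (h' a)) ->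
  computable (k + l) (fun x => h' (h x) x).
Proof.
move=> [t td te] c'.
(* Finiteness of [A] allows choosing one continuation tree for each value of [h x]. *)
have /fin_all_exists[s sP] (a : A) : exists s : dtree P B,
    dt_depth s <= l * b /\ forall x, dt_eval s x = h' a x.
  by have [s] := c' a; exists s.
exists (dt_bind t s) => [|x]; last by rewrite dt_eval_bind te; case: (sP (h x)).
apply: (@leq_trans (dt_depth t + l * b)).
  by apply: dt_depth_bind => a; case: (sP a).
by rewrite mulnDl leq_add2r.
Qed.

Lemma computable_map (A : finType) (B : Type) (k : nat) (h : input P -> A)
    (j : A -> B) : computable k h -> computable k (fun x => j (h x)).
Proof.
move=> c; apply: (@computable_le _ (k + 0)); first by rewrite addn0.
by apply: (computable_bind (h' := fun a _ => j a)) c _ => a; apply: computable_const.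
Qed.

Lemma computable_map2 (A B : finType) (C : Type) (k l : nat)
    (h : input P -> A) (h' : input P -> B) (j : A -> B -> C) :
    computable k h -> computable l h' ->
  computable (k + l) (fun x => j (h x) (h' x)).
Proof.
move=> c c'; apply: (computable_bind (h' := fun a x => j a (h' x))) c _ => a.
exact: (computable_map (j a)) c'.
Qed.

(** Only one branch is run, so the two branches share the budget [l]. *)
Lemma computable_if (O : Type) (k l : nat) (c : input P -> bool)
    (h h' : input P -> O) : computable k c -> computable l h ->
  computable l h' -> computable (k + l) (fun x => if c x then h x else h' x).
Proof.
move=> cc ch ch'.
by apply: (computable_bind (h' := fun a x => if a then h x else h' x)) cc _; case.
Qed.

End Computation.

(** * Query costs of the reduction *)

Section NephewQueries.

Variable n : nat.

Let V := 'I_n.+1.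
Let P := Nephew_w_Inverse n.
(** The largest alphabet of [P] is [option 'I_n.+1], with [n.+2] symbols. *)
Let b := up_log 2 n.+2.
Let f (x : input P) : V -> V := fun u => x (inl (inl u)).
Let g (x : input P) : V -> V := fun u => x (inl (inr u)).
Let finv (x : input P) : V -> option V := fun u => x (inr u).

Lemma computable_f (k : nat) (h : input P -> V) :
  computable b k h -> computable b (k + 1) (fun x => f x (h x)).
Proof.
move=> c; apply: (computable_bind (h' := fun u x => f x u)) c _ => u.
by apply: (@computable_query P b (inl (inl u))); rewrite /sym_bits card_ord leq_up_log.
Qed.

Lemma computable_g (k : nat) (h : input P -> V) :
  computable b k h -> computable b (k + 1) (fun x => g x (h x)).
Proof.
move=> c; apply: (computable_bind (h' := fun u x => g x u)) c _ => u.
by apply: (@computable_query P b (inl (inr u))); rewrite /sym_bits card_ord leq_up_log.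
Qed.

Lemma computable_finv (u : V) : computable b 1 (fun x => finv x u).
Proof.
by apply: (@computable_query P b (inr u)); rewrite /sym_bits card_option card_ord.
Qed.

Lemma computable_sib (k : nat) (h : input P -> V) :
  computable b k h -> computable b (k + 1 + 1) (fun x => sib (f x) (g x) (h x)).
Proof. by move=> c; apply/computable_f/computable_g. Qed.

Lemma computable_child (u : V) :
  computable b 3 (fun x => child (f x) (g x) (finv x) u).
Proof.
apply: (computable_bind (k := 1) (l := 2)
  (h' := fun w x => if w is Some w then w else g x (f x u))).
  exact: computable_finv.
case=> [w|]; first exact/(@computable_le _ _ _ 0)/computable_const.
exact/(@computable_g 1)/(@computable_f 0)/computable_const.
Qed.

Lemma computable_has_child (u : V) :
  computable b 4 (fun x => has_child (f x) (g x) (finv x) u).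
Proof.
apply: (computable_map (eq_op^~ u)).
exact/(@computable_f 3)/computable_child.
Qed.

Lemma computable_fixed (u : V) : computable b 1 (fun x => f x u == u).
Proof.
apply: (computable_map (eq_op^~ u)).
exact/(@computable_f 0)/computable_const.
Qed.

Lemma computable_parent (u : V) :
  computable b 5 (fun x => parent (f x) (g x) (finv x) u).
Proof.
apply: (computable_if (k := 4) (l := 1)); first exact: computable_has_child.
  exact/(@computable_f 0)/computable_const.
exact/(@computable_le _ _ _ 0)/computable_const.
Qed.

Lemma computable_left_child (u : V) :
  computable b 8 (fun x => left_child (f x) (g x) (finv x) u).
Proof.
apply: (computable_if (k := 4) (l := 4)); first exact: computable_has_child.
  apply: (computable_if (k := 1) (l := 3)); first exact: computable_fixed.
    exact/(@computable_le _ _ _ 0)/computable_const.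
  exact: computable_child.
exact/(@computable_le _ _ _ 0)/computable_const.
Qed.

Lemma computable_right_child (u : V) :
  computable b 10 (fun x => right_child (f x) (g x) (finv x) u).
Proof.
apply: (computable_if (k := 4) (l := 6)); first exact: computable_has_child.
  apply: (computable_if (k := 1) (l := 5)); first exact: computable_fixed.
    apply: (@computable_le _ _ _ 2) => //.
    exact/(@computable_sib 0)/computable_const.
  exact/(@computable_sib 3)/computable_child.
exact/(@computable_le _ _ _ 0)/computable_const.
Qed.

Lemma computable_root (o : V) :
  computable b 8 (fun x => root o (f x) (g x) (finv x)).
Proof.
apply: (computable_if (k := 5) (l := 3)).
- apply: (computable_map2 (k := 4) (l := 1) (fun c e => c && ~~ e)).
    exact: computable_has_child.
  exact: computable_fixed.
- exact/(@computable_le _ _ _ 0)/computable_const.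
- exact/(@computable_sib 1)/(@computable_f 0)/computable_const.
Qed.

(** Repeated queries are counted anew: the four clauses take 4, 2, 2 and 4 queries. *)
Lemma computable_bad (u : V) :
  computable b 12 (fun x => bad (f x) (g x) (finv x) u).
Proof.
have c0 : computable b 0 (fun _ : input P => u) by apply: computable_const.
apply: (computable_map2 (k := 4) (l := 8) orb).
  apply: (computable_map2 (k := 3) (l := 1) (fun v w => v != w)).
    exact/(@computable_f 2)/(@computable_sib 0).
  exact: (@computable_f 0).
apply: (computable_map2 (k := 2) (l := 6) orb).
  exact/(computable_map (eq_op^~ u))/(@computable_sib 0).
apply: (computable_map2 (k := 2) (l := 4) orb).
  apply: (computable_bind (k := 1) (l := 1)
    (h' := fun w x => if w is Some w then f x w != u else false)).
    exact: computable_finv.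
  case=> [w|]; last exact/(@computable_le _ _ _ 0)/computable_const.
  apply: (computable_map (fun v => v != u)).
  exact/(@computable_f 0)/computable_const.
apply: (computable_map2 (k := 1) (l := 3) (fun w e => (w == None) && e)).
  exact: computable_finv.
apply: (computable_map2 (k := 2) (l := 1) (fun v w => v != w)).
  exact/(@computable_f 1)/(@computable_f 0).
exact: (@computable_f 0).
Qed.

Lemma computable_bad_or (k l : nat) (h h' : input P -> V) :
    computable b k h -> computable b l h' ->
  computable b (k + (12 + l))
    (fun x => bad_or (f x) (g x) (finv x) (h x) (h' x)).
Proof.
move=> c c'.
apply: (computable_bind
  (h' := fun u x => bad_or (f x) (g x) (finv x) u (h' x))) c _ => u.
apply: computable_if c'; first exact: computable_bad.
exact/(@computable_le _ _ _ 0)/computable_const.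
Qed.

Lemma computable_tree_witness (o u : V) :
  computable b 86 (fun x => tree_witness o (f x) (g x) (finv x) u).
Proof.
have c0 (v : V) : computable b 0 (fun _ : input P => v).
  exact: computable_const.
(* The six tests of [bad] take 12 queries each; the seven candidates take 0, 2, 3, 5, 0, 1 and 3. *)
apply: (@computable_bad_or 0 74) => //.
apply: (@computable_bad_or 2 60); first exact: (@computable_sib 0).
apply: (@computable_bad_or 3 45); first exact: computable_child.
apply: (@computable_bad_or 5 28).
  exact/(@computable_sib 3)/computable_child.
apply: (@computable_bad_or 0 16) => //.
apply: (@computable_bad_or 1 3); first exact: (@computable_f 0).
exact/(@computable_sib 1)/(@computable_f 0).
Qed.

(** The root depends on the input, so each tree first finds it, in 8 queries; the transposition is
    then known. *)
Lemma computable_move_root (o u : V) (k : nat) (h : input P -> V -> V) :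
    (forall v, computable b k (fun x => h x v)) ->
  computable b (8 + k)
    (fun x => move_root o (f x) (g x) (finv x) (h x) u).
Proof.
move=> ch.
apply: (computable_bind (h' := fun r x => tperm o r (h x (tperm o r u)))).
  exact: computable_root.
by move=> r; apply: computable_map.
Qed.

Lemma computable_moved_witness (o u : V) :
  computable b 94 (fun x =>
    tree_witness o (f x) (g x) (finv x)
      (tperm o (root o (f x) (g x) (finv x)) u)).
Proof.
apply: (computable_bind (k := 8) (l := 86)
  (h' := fun r x => tree_witness o (f x) (g x) (finv x) (tperm o r u))).
  exact: computable_root.
by move=> r; apply: computable_tree_witness.
Qed.

Lemma bad_solves (x : input P) (u : V) :
  bad (f x) (g x) (finv x) u -> @solves P x u.
Proof.
case/or4P=> [/eqP | /eqP | e | /andP[/eqP ? /eqP ?]].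
- exact: Or41.
- exact: Or42.
- apply: Or43; rewrite -/(finv x u).
  by case: (finv x u) e => // w /eqP; exists w.
- by apply: Or44.
Qed.

(** The vertex set is kept and [o] is [ord0]. The witness costs 94 queries, which dominates the 13,
    16 and 18 of the three maps. *)
Lemma nephew_formulation : dt_formulation P (Empty_Child' n) (94 * b).
Proof.
pose T_spec (q : qry (Empty_Child' n)) (x : input P) : V :=
  let mv h u := move_root ord0 (f x) (g x) (finv x)
                  (h (f x) (g x) (finv x)) u in
  match q with
  | inl (inl u) => mv (@parent V) u
  | inl (inr u) => mv (@left_child V) u
  | inr u => mv (@right_child V) u
  end.
have cT q : computable b 94 (T_spec q).
  case: q => [[u|u]|u].
  - apply: (@computable_le _ _ _ 13) => //.
    exact/computable_move_root/computable_parent.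
  - apply: (@computable_le _ _ _ 16) => //.
    exact/computable_move_root/computable_left_child.
  - apply: (@computable_le _ _ _ 18) => //.
    exact/computable_move_root/computable_right_child.
have /fin_all_exists[T TP] q : exists t : dtree P V,
    dt_depth t <= 94 * b /\ forall x, dt_eval t x = T_spec q x.
  by have [t] := cT q; exists t.
have /fin_all_exists[G GP] (u : V) : exists t : dtree P V,
    dt_depth t <= 94 * b /\ forall x, dt_eval t x =
      tree_witness ord0 (f x) (g x) (finv x)
        (tperm ord0 (root ord0 (f x) (g x) (finv x)) u).
  by have [t] := computable_moved_witness ord0 u; exists t.
exists T, G; split=> [q | u | x u sol]; [exact: (TP q).1 | exact: (GP u).1 |].
rewrite (GP u).2; apply/bad_solves/move_root_witnessP.
by move: sol; rewrite /= /empty_child'_solution !(TP _).2.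
Qed.

(** * Input lengths and the polylogarithmic bound *)

Lemma input_length_empty_child'_le :
  input_length (Empty_Child' n) <= input_length P.
Proof.
apply: leq_sum => -[q|q] _ //=.
by rewrite /sym_bits /= card_option card_ord leq_up_log.
Qed.

(** The positions of the inverse suffice: [option 'I_n.+1] has at least two symbols, so each costs a
    bit, even for [n = 0], where those of [f] and [g] cost none. *)
Lemma input_length_nephew_ge : n < input_length P.
Proof.
rewrite /input_length big_sumType /=.
apply: leq_trans (leq_addl _ _).
rewrite -[X in X <= _](card_ord n.+1) -sum1_card.
by apply: leq_sum => u _; rewrite /sym_bits /= card_option card_ord up_log_gt0.
Qed.

Lemma vertex_bits_le : b <= (up_log 2 (input_length P)).+1.
Proof.
apply: up_log_min => //; rewrite expnS.
have := input_length_nephew_ge => nl.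
(* The length is at least [n.+1] and at least 1, so twice the length reaches [n.+2]; the factor 2 is
   the extra bit. *)
apply: (@leq_trans (2 * input_length P)).
  by rewrite mul2n -addnn (@leq_add 1 n.+1) // (leq_trans _ nl).
by rewrite leq_mul2l /= up_logP.
Qed.

End NephewQueries.

Theorem theorem5p13 : dt_reducible Nephew_w_Inverse Empty_Child'.
Proof.
(* With [l] the logarithm of the source length, the total is at most [95 * (l + 2)], and
   [95 <= 2 ^ 7 <= (l + 2) ^ 7]; hence the exponent 8. *)
exists 8 => n; exists n, (94 * up_log 2 n.+2).
split; first exact: nephew_formulation.
set l := up_log 2 (input_length (Nephew_w_Inverse n)).
apply: (@leq_trans (95 * (l + 2))).
  rewrite -[95]/(1 + 94) mulnDl mul1n leq_add //.
    apply: leq_trans (leq_addr _ _).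
    exact/leq_up_log/input_length_empty_child'_le.
  rewrite leq_mul2l addn2 ltnW // ltnS; exact: vertex_bits_le.
rewrite (expnSr _ 7) leq_mul2r; apply/orP; right.
by apply: (@leq_trans (2 ^ 7)); rewrite // leq_exp2r // leq_addl.
Qed.
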